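(* Let $n\ge3$ be an integer, and let $a_{p,i}$ be integers for $p$ prime and $1\le i\le n-2$, with $a_{p,1}\ne0$ for every prime $p$. Then the number of isomorphism classes of filtered $\lambda$-ring structures $R$ on $\mathbf{Z}[x]/(x^n)$ satisfying \[\psi^p_R(x)\equiv a_{p,1}x+\cdots+a_{p,n-2}x^{n-2}\pmod{x^{n-1}}\] for all primes $p$ is at most $\min\{|a_{p,1}^{n-1}-a_{p,1}|\colon p\text{ prime}\}$.
   Context: A (special) $\lambda$-ring is a commutative ring with operations $\lambda^i$ satisfying the Atiyah–Tall axioms; a filtered $\lambda$-ring is a $\lambda$-ring with decreasing filtration by ideals closed under $\lambda^i$, $i\ge1$; isomorphisms are filtration-preserving $\lambda$-ring isomorphisms. $\mathbf{Z}[x]/(x^n)$ is filtered with $x$ in filtration exactly $d$ for some fixed $d\ge1$, i.e. $I^k$ is generated by the $x^j$ with $jd\ge k$. A filtered $\lambda$-ring structure $R$ on it is determined by the polynomials $\psi^p_R(x)$ (the Adams operations applied to $x$) for primes $p$. *)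

(* Defs.v *)
From HB Require Import structures.
From mathcomp Require Import all_boot all_order all_algebra.
From mathcomp Require Import mpoly.
Set Implicit Arguments. Unset Strict Implicit. Unset Printing Implicit Defensive.
Import Order.TTheory GRing.Theory Num.Theory.
Local Open Scope ring_scope.

(** * The ring Z[x]/(x^n), modelled on representatives in {poly int}.
    An element of Z[x]/(x^n) is represented by any polynomial p : {poly int};
    two representatives are equal in the quotient iff they have the same
    truncation [tr n] (coefficients of degree < n).  Since [tr n] is a ring
    morphism Z[x] -> Z[x]/(x^n), all ring operations can be computed on
    representatives and truncated at the end. *)
Definition tr (n : nat) (p : {poly int}) : {poly int} := take_poly n p.

Definition lamops := nat -> {poly int} -> {poly int}.

(** Target for P_k: the coefficient of t^k in prod_{i,j<k} (1 + xi_i eta_j t),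
    i.e. e_k of the k^2 products xi_i eta_j, in Z[xi_0..xi_{k-1},eta_0..eta_{k-1}]
    (xi_i = 'X_(lshift k i), eta_j = 'X_(rshift k j)). *)
Definition Pk_target (k : nat) : {mpoly int[k + k]} :=
  \sum_(S : {set ('I_k * 'I_k)} | #|S| == k)
     \prod_(ij in S) (('X_(lshift k ij.1) : {mpoly int[k + k]}) * 'X_(rshift k ij.2)).

Definition Pk_args (k : nat) : (k + k).-tuple {mpoly int[k + k]} :=
  [tuple match split i with
         | inl a => mesym k int a.+1 \mPo [tuple ('X_(lshift k j) : {mpoly int[k + k]}) | j < k]
         | inr b => mesym k int b.+1 \mPo [tuple ('X_(rshift k j) : {mpoly int[k + k]}) | j < k]
         end | i < k + k].

(** Q is the universal polynomial P_k(a_1..a_k; b_1..b_k): Q(e(xi), e(eta)) equals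
    the target.  (Such Q exists and is unique by the fundamental theorem of
    symmetric polynomials / algebraic independence of the e_i.) *)
Definition is_Pk (k : nat) (Q : {mpoly int[k + k]}) : Prop :=
  Q \mPo Pk_args k = Pk_target k.

(** Target for P_{k,j}: the coefficient of t^k in
    prod_{S subset [kj], |S| = j} (1 + (prod_{i in S} xi_i) t), in kj variables. *)
Definition Pkj_target (k j : nat) : {mpoly int[k * j]} :=
  \sum_(F : {set {set 'I_(k * j)}} | (#|F| == k) && [forall S in F, #|S| == j])
     \prod_(S in F) \prod_(i in S) ('X_i : {mpoly int[k * j]}).

Definition is_Pkj (k j : nat) (Q : {mpoly int[k * j]}) : Prop :=
  Q \mPo [tuple mesym (k * j) int i.+1 | i < k * j] = Pkj_target k j.

Definition is_lambda_ring (n : nat) (lam : lamops) : Prop :=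
      (forall i p q, tr n p = tr n q -> tr n (lam i p) = tr n (lam i q)) /\
      (forall p, tr n (lam 0%N p) = tr n 1) /\
      (forall p, tr n (lam 1%N p) = tr n p) /\
      (forall k p q, tr n (lam k (p + q)) =
                     tr n (\sum_(i < k.+1) lam i p * lam (k - i)%N q)) /\
      (forall k, (2 <= k)%N -> tr n (lam k 1) = 0) /\
      (forall k (Q : {mpoly int[k + k]}) p q, (0 < k)%N -> is_Pk Q ->
         tr n (lam k (p * q)) =
         tr n (mmap (@polyC int)
                 (fun i : 'I_(k + k) => match split i with
                                        | inl a => lam a.+1 p
                                        | inr b => lam b.+1 q end) Q)) /\
      (forall k j (Q : {mpoly int[k * j]}) p, (0 < k)%N -> (0 < j)%N -> is_Pkj Q ->
         tr n (lam k (lam j p)) =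
         tr n (mmap (@polyC int) (fun i : 'I_(k * j) => lam i.+1 p) Q)).

(** ** The filtration: x in filtration exactly d.  I^k is generated by the x^j
    with j*d >= k, i.e. p is in I^k iff its coefficients of degree j < n with
    j*d < k vanish. *)
Definition inFil (n d k : nat) (p : {poly int}) : Prop :=
  forall j : nat, (j < n)%N -> (j * d < k)%N -> p`_j = 0.

Definition is_filtered_lambda_ring (n d : nat) (lam : lamops) : Prop :=
  is_lambda_ring n lam /\
  (forall i k p, (1 <= i)%N -> inFil n d k p -> inFil n d k (lam i p)).

Definition filtered_lambda_iso (n d : nat) (lam1 lam2 : lamops)
    (f g : {poly int} -> {poly int}) : Prop :=
      (forall p q, tr n p = tr n q -> tr n (f p) = tr n (f q)) /\
      (forall p q, tr n p = tr n q -> tr n (g p) = tr n (g q)) /\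
      (forall p q, tr n (f (p + q)) = tr n (f p + f q)) /\
      (forall p q, tr n (f (p * q)) = tr n (f p * f q)) /\
      (tr n (f 1) = tr n 1) /\
      (forall p, tr n (g (f p)) = tr n p) /\ (forall p, tr n (f (g p)) = tr n p) /\
      (forall k p, inFil n d k p -> inFil n d k (f p)) /\
      (forall k p, inFil n d k p -> inFil n d k (g p)) /\
      (forall i p, tr n (f (lam1 i p)) = tr n (lam2 i (f p))).

Definition fl_isomorphic (n d : nat) (lam1 lam2 : lamops) : Prop :=
  exists f g, filtered_lambda_iso n d lam1 lam2 f g.

(** ** Adams operations, via Newton's formula
    psi^m = sum_{i=1}^{m-1} (-1)^{i-1} lambda^i psi^{m-i} + (-1)^{m-1} m lambda^m. *)
Fixpoint psis (lam : lamops) (x : {poly int}) (m : nat) : seq {poly int} :=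
  match m with
  | 0 => [::]
  | m'.+1 =>
      let s := psis lam x m' in
      rcons s (\sum_(j < m') ((-1) ^+ j * lam j.+1 x * nth 0 s (m' - j.+1)%N)
               + (-1) ^+ m' * (m'.+1)%:R * lam m'.+1 x)
  end.

(** psi^m(x) for m >= 1 (as a representative). *)
Definition psi (lam : lamops) (m : nat) (x : {poly int}) : {poly int} :=
  nth 0 (psis lam x m) m.-1.

(* Main.v *)
(** Write [psi^p] for the Adams operations and [N = n - 1].  Newton's formula and
    the universal polynomials of the lambda-ring axioms make the [psi^k] commuting
    ring endomorphisms of the torsion-free ring Z[x]/(x^(N+1)), and a ring
    endomorphism commuting with all the [psi^p] is a lambda-homomorphism.

    Let [delta_p] be the difference of the coefficients of [x^N] in [psi^p(x)]
    for two of the structures.  Comparing the coefficients of [x^N] in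
    [psi^p psi^q = psi^q psi^p] gives
      [delta_q (a_p^N - a_p) = delta_p (a_q^N - a_q)].
    So if [delta_p] is a multiple [c (a_p^N - a_p)] for one prime [p], then it is so
    for all primes with the same [c], and [x |-> x + c x^N] is an isomorphism.
    Hence the classes are separated by the coefficient of [x^N] modulo
    [a_p^N - a_p], which is nonzero because [p] divides [a_p]. *)
Require Import Defs.
From HB Require Import structures.
From mathcomp Require Import all_boot all_order all_algebra.
From mathcomp Require Import perm qpoly ring zify.
From mathcomp Require Import mpoly.
Set Implicit Arguments. Unset Strict Implicit. Unset Printing Implicit Defensive.
Import Order.TTheory GRing.Theory Num.Theory.
Local Open Scope ring_scope.

(** * Newton's identities *)

Definition torsion_free (V : zmodType) : Prop :=
  forall (k : nat) (x : V), (0 < k)%N -> x *+ k = 0 -> x = 0.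

Lemma torsion_free_inj (V : zmodType) (k : nat) (x y : V) :
  torsion_free V -> (0 < k)%N -> x *+ k = y *+ k -> x = y.
Proof.
move=> tf k0 e; apply/eqP; rewrite -subr_eq0; apply/eqP/(tf k) => //.
by rewrite mulrnBl e subrr.
Qed.

Section CourseOfValues.
Variables (T : Type) (x0 : T) (step : nat -> seq T -> T).

(** The earlier values are kept in a list, in the same shape as [psis], so that [psi_power_sum]
    becomes a plain induction. *)
Fixpoint history (m : nat) : seq T :=
  if m is m'.+1 then rcons (history m') (step m' (history m')) else [::].

Lemma size_history m : size (history m) = m.
Proof. by elim: m => //= m IH; rewrite size_rcons IH. Qed.

Lemma nth_history m i : (i < m)%N -> nth x0 (history m) i = step i (history i).
Proof.
elim: m => //= m IH; rewrite ltnS leq_eqVlt nth_rcons size_history.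
by case/predU1P=> [->|im]; rewrite ?ltnn ?eqxx // im IH.
Qed.
End CourseOfValues.

Section Newton.
Variable R : comNzRingType.
Implicit Types (u v P Q : nat -> R).

(* [P] is the sequence of power sums of a family of "roots" whose elementary
   symmetric functions are [u]; the value [P 0] is irrelevant. *)
Definition newton u P : Prop :=
  u 0%N = 1 /\
  forall k, u k.+1 *+ k.+1 = \sum_(i < k.+1) (-1) ^+ i * u (k - i)%N * P i.+1.

(** Since [u 0 = 1], the identity of index [k] contains [P k.+1] with coefficient [(-1) ^+ k], so
    power sums are determined recursively without division. *)
Lemma newton_unique M u v P Q : (forall i, (i <= M)%N -> u i = v i) ->
  newton u P -> newton v Q -> forall i, (0 < i <= M)%N -> P i = Q i.
Proof.
move=> uv [u0 nu] [v0 nv]; elim/ltn_ind => -[//|k] IH /= kM.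
have := nu k; rewrite uv // nv !big_ord_recr /= subnn u0 v0.
rewrite (eq_bigr (fun i : 'I_k => (-1) ^+ i * u (k - i)%N * P i.+1)); last first.
  move=> i _; have /= ik := ltn_ord i; rewrite uv; last by lia.
  by rewrite IH //; lia.
move/addrI; rewrite !mulr1 => /(congr1 ( *%R ((-1) ^+ k))).
by rewrite !signrMK.
Qed.

(** Newton's formula solved for the power sum of index [m.+1]; entry [i] of [s] stands for the power
    sum of index [i.+1]. *)
Definition power_sum_step u (m : nat) (s : seq R) : R :=
  \sum_(j < m) ((-1) ^+ j * u j.+1 * nth 0 s (m - j.+1)%N)
  + (-1) ^+ m * m.+1%:R * u m.+1.

Definition power_sum u (m : nat) : R :=
  nth 0 (history (power_sum_step u) m) m.-1.

Lemma power_sumS u m : power_sum u m.+1 =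
  \sum_(j < m) ((-1) ^+ j * u j.+1 * power_sum u (m - j)%N)
  + (-1) ^+ m * m.+1%:R * u m.+1.
Proof.
rewrite /power_sum nth_history //; congr (_ + _).
apply: eq_bigr => j _; congr (_ * _); have /= jm := ltn_ord j.
have -> : (m.+1.-1 - j.+1 = (m - j).-1)%N by lia.
by rewrite !nth_history //; lia.
Qed.

Lemma newton_power_sum u : u 0%N = 1 -> newton u (power_sum u).
Proof.
move=> u0; split=> // k; rewrite big_ord_recr /= subnn u0 mulr1 power_sumS.
rewrite mulrDr -mulrA signrMK mulr_natl addrA mulr_sumr.
(* Reversing the order of summation pairs each term with one of opposite sign. *)
rewrite (reindex_inj rev_ord_inj) /= -big_split big1 ?add0r //= => j _.
have /= jk := ltn_ord j.
have -> : (k - (k - j.+1) = j.+1)%N by lia.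
have -> : (k - j.+1).+1 = (k - j)%N by lia.
rewrite !mulrA -exprD -!mulrDl.
have -> : (-1) ^+ (k + j) = - (-1) ^+ (k - j.+1) :> R.
  have -> : (k + j = (k - j.+1) + j.*2.+1)%N by lia.
  by rewrite exprD exprS -mul2n exprM sqrrN !expr1n mulr1 mulrN1.
by rewrite subrr !mul0r.
Qed.

(** Newton's identity times the factorial of [m']: the entry of index [m' - i] absorbs its own
    factorial, which leaves the falling factorial [m' ^_ i]. *)
Definition factorial_esym_step P (m : nat) (s : seq R) : R :=
  if m is m'.+1 then
    \sum_(i < m) (-1) ^+ i * (m' ^_ i)%:R * nth 0 s (m' - i)%N * P i.+1
  else 1.

(* [k`!] times the [k]-th elementary symmetric function of a family with power
   sums [P]; the factor [k`!] keeps the expression integral. *)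
Definition factorial_esym P (k : nat) : R :=
  nth 0 (history (factorial_esym_step P) k.+1) k.

Lemma factorial_esym0 P : factorial_esym P 0 = 1.
Proof. by []. Qed.

Lemma factorial_esymS P k : factorial_esym P k.+1 =
  \sum_(i < k.+1) (-1) ^+ i * (k ^_ i)%:R * factorial_esym P (k - i)%N * P i.+1.
Proof.
rewrite /factorial_esym nth_history //; apply: eq_bigr => i _.
by rewrite !nth_history //; lia.
Qed.

Lemma eq_factorial_esym k P Q : (forall i, (0 < i <= k)%N -> P i = Q i) ->
  factorial_esym P k = factorial_esym Q k.
Proof.
elim/ltn_ind: k => -[//|k] IH PQ; rewrite !factorial_esymS.
apply: eq_bigr => i _; have /= ik := ltn_ord i; rewrite (PQ i.+1); last by lia.
by rewrite (IH (k - i)%N) // => [|j jk]; [lia | apply: PQ; lia].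
Qed.

Lemma newton_factorial_esym u P k : newton u P ->
  u k *+ k`! = factorial_esym P k.
Proof.
move=> [u0 nu]; elim/ltn_ind: k => -[|k] IH; first by rewrite u0.
rewrite factS mulrnA nu factorial_esymS -sumrMnl.
apply: eq_bigr => i _; have /= ik := ltn_ord i.
rewrite -IH; last by lia.
rewrite -[LHS]mulr_natr -(@ffact_fact k i) // natrM -(mulr_natr (u (k - i)%N)); ring.
Qed.

(** Torsion-freeness cancels the factorials, so Newton's identities can be verified on factorial
    multiples. *)
Lemma factorial_esym_newton u P : torsion_free R ->
  (forall k, u k *+ k`! = factorial_esym P k) -> newton u P.
Proof.
move=> tf E; split=> [|k]; first by have := E 0%N.
apply: (torsion_free_inj tf (fact_gt0 k)).
rewrite -mulrnA -factS E factorial_esymS -sumrMnl.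
apply: eq_bigr => i _; have /= ik := ltn_ord i.
rewrite -E -[RHS]mulr_natr -(@ffact_fact k i) // natrM -(mulr_natr (u (k - i)%N)); ring.
Qed.

(** [P k.+1] occurs only in the last summand, with coefficient plus or minus the factorial of [k],
    which torsion-freeness cancels. This drives the inductions on Adams operations below. *)
Lemma factorial_esym_last k P Q : torsion_free R ->
  (forall i, (0 < i <= k)%N -> P i = Q i) ->
  factorial_esym P k.+1 = factorial_esym Q k.+1 -> P k.+1 = Q k.+1.
Proof.
move=> tf PQ; rewrite !factorial_esymS !big_ord_recr /= subnn.
rewrite (eq_bigr (fun i : 'I_k =>
  (-1) ^+ i * (k ^_ i)%:R * factorial_esym Q (k - i) * Q i.+1)); last first.
  move=> i _; have /= ik := ltn_ord i; rewrite PQ //.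
  rewrite (@eq_factorial_esym _ P Q) // => j jk; apply: PQ; lia.
move/addrI; rewrite !factorial_esym0 !mulr1 -!mulrA => /(congr1 ( *%R ((-1) ^+ k))).
rewrite !signrMK ffactnn !mulr_natl; exact: (torsion_free_inj tf (fact_gt0 k)).
Qed.

Lemma eq_newton u v P Q : u =1 v -> P =1 Q -> newton u P -> newton v Q.
Proof.
move=> uv PQ [u0 nu]; split=> [|k]; rewrite -uv // nu.
by apply: eq_bigr => i _; rewrite uv PQ.
Qed.

(** Newton's identities say that the alternating generating series [nf P] of the power sums is the
    logarithmic derivative of the generating series of [u]; logarithmic derivatives of a product add
    up. *)
Lemma newton_mul u v P Q : newton u P -> newton v Q ->
  newton (fun k => \sum_(i < k.+1) u i * v (k - i)%N) (fun k => P k + Q k).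
Proof.
move=> [u0 nu] [v0 nv]; split=> [|k]; first by rewrite big_ord1 u0 v0 mulr1.
(* Only coefficients of index at most [k.+1] enter the identity, so truncated series suffice. *)
pose f := \poly_(i < k.+2) u i; pose g := \poly_(i < k.+2) v i.
have fE i : (i <= k.+1)%N -> f`_i = u i by move=> ik; rewrite coef_poly ltnS ik.
have gE i : (i <= k.+1)%N -> g`_i = v i by move=> ik; rewrite coef_poly ltnS ik.
pose nf (P : nat -> R) := \poly_(i < k.+1) ((-1) ^+ i * P i.+1).
have dE w W (h : {poly R}) : (forall i, (i <= k.+1)%N -> h`_i = w i) ->
    (forall j, w j.+1 *+ j.+1 = \sum_(i < j.+1) (-1) ^+ i * w (j - i)%N * W i.+1) ->
  forall i, (i <= k)%N -> h^`()`_i = (nf W * h)`_i.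
  move=> hE nw i ik; rewrite coef_deriv hE // nw coefM.
  apply: eq_bigr => j _; have /= jk := ltn_ord j; rewrite coef_poly hE; last by lia.
  by rewrite ifT; [rewrite mulrAC | lia].
transitivity ((f * g)^`())`_k.
  rewrite coef_deriv coefM; congr (_ *+ _).
  apply: eq_bigr => i _; have /= ik := ltn_ord i; rewrite fE ?gE //; lia.
transitivity ((nf (fun k => P k + Q k)) * (f * g))`_k; last first.
  rewrite coefM; apply: eq_bigr => i _; have /= ik := ltn_ord i.
  rewrite coef_poly ltn_ord mulrAC coefM; congr (_ * _ * _).
  apply: eq_bigr => j _; have /= jk := ltn_ord j; rewrite fE ?gE //; lia.
have -> : nf (fun k => P k + Q k) = nf P + nf Q.
  by apply/polyP => i; rewrite coefD !coef_poly; case: ifP => _; rewrite ?addr0 ?mulrDr.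
rewrite derivM.
have -> : (nf P + nf Q) * (f * g) = nf P * f * g + f * (nf Q * g) by ring.
rewrite !coefD; congr (_ + _).
  rewrite !coefM; apply: eq_bigr => i _; have /= ik := ltn_ord i.
  by rewrite (dE u P).
rewrite !coefM; apply: eq_bigr => i _; have /= ik := ltn_ord i.
by rewrite (dE v Q) //; lia.
Qed.

Lemma newton_one : newton (nth 0 (1 : {poly R})) (fun=> 0).
Proof.
split=> [|k]; first by rewrite coef1.
by rewrite coef1 /= mul0rn big1 // => i _; rewrite mulr0.
Qed.

Lemma newton_prod (I : finType) (f : I -> {poly R}) (P : I -> nat -> R) :
  (forall i, newton (nth 0 (f i)) (P i)) ->
  newton (nth 0 (\prod_i f i)) (fun k => \sum_i P i k).
Proof.
move=> nf; elim: (index_enum I) => [|i s IH].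
  by apply: eq_newton newton_one => k; rewrite big_nil.
by apply: eq_newton (newton_mul (nf i) IH) => k; rewrite big_cons ?coefM.
Qed.

Lemma newton_scale u P (x : R) : newton u P ->
  newton (fun a => x ^+ a * u a) (fun l => x ^+ l * P l).
Proof.
move=> [u0 nu]; split=> [|k]; first by rewrite u0 mulr1.
rewrite -mulrnAr nu mulr_sumr; apply: eq_bigr => i _; have /= ik := ltn_ord i.
have -> : x ^+ k.+1 = x ^+ (k - i) * x ^+ i.+1 by rewrite -exprD; congr (_ ^+ _); lia.
ring.
Qed.

Lemma newton_linear (x : R) : newton (nth 0 (1 + x *: 'X)) (fun l => x ^+ l).
Proof.
have E i : (1 + x *: 'X)`_i = (i == 0)%N%:R + x * (i == 1)%N%:R.
  by rewrite coefD coef1 coefZ coefX.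
split=> [|[|k]]; first by rewrite E mulr0 addr0.
  by rewrite big_ord1 !E /=; ring.
rewrite !big_ord_recr /= big1 => [|i _].
  by rewrite subnn subSnn !E /= !exprS; ring.
have /= ik := ltn_ord i; rewrite E.
have -> : (k.+1 - i == 0)%N = false by lia.
have -> : (k.+1 - i == 1)%N = false by lia.
by rewrite mulr0 addr0 mulr0 mul0r.
Qed.

Definition esym (I : finType) (x : I -> R) (k : nat) : R :=
  \sum_(S : {set I} | #|S| == k) \prod_(i in S) x i.

Lemma esymE (I : finType) (x : I -> R) k :
  esym x k = (\prod_i (1 + x i *: 'X))`_k.
Proof.
rewrite (eq_bigr (fun i => x i *: 'X + 1)) => [|i _]; last by rewrite addrC.
rewrite bigA_distr coef_sum /esym big_mkcond; apply: eq_bigr => S _ /=.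
rewrite -big_mkcond /= scaler_prodr coefZ coefXn eq_sym.
by case: eqP; rewrite ?mulr1 ?mulr0.
Qed.

Lemma newton_esym (I : finType) (x : I -> R) :
  newton (esym x) (fun l => \sum_i x i ^+ l).
Proof.
by apply: eq_newton (newton_prod (fun i => newton_linear (x i))) => k //; rewrite esymE.
Qed.


End Newton.

(** * Universal polynomials *)

Section NewtonMorphism.
Variables (R S : comNzRingType) (f : {rmorphism R -> S}).

Lemma newton_rmorph (u P : nat -> R) :
  newton u P -> newton (f \o u) (f \o P).
Proof.
move=> [u0 nu]; split=> [|k] /=; first by rewrite u0 rmorph1.
rewrite -rmorphMn /= nu rmorph_sum; apply: eq_bigr => i _.
by rewrite !rmorphM rmorphXn rmorphN1.
Qed.

Lemma rmorph_factorial_esym (P : nat -> R) k :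
  f (factorial_esym P k) = factorial_esym (f \o P) k.
Proof.
elim/ltn_ind: k => -[|k] IH; first by rewrite !factorial_esym0 rmorph1.
rewrite !factorial_esymS rmorph_sum; apply: eq_bigr => i _.
have /= ik := ltn_ord i.
by rewrite !rmorphM rmorphXn rmorphN1 rmorph_nat IH //; lia.
Qed.

Lemma rmorph_mmap (A : comNzRingType) (n : nat) (g : A -> R) (h : 'I_n -> R)
  (p : {mpoly A[n]}) : f (mmap g h p) = mmap (f \o g) (f \o h) p.
Proof.
rewrite /mmap rmorph_sum; apply: eq_bigr => m _; rewrite rmorphM /mmap1 rmorph_prod.
by congr (_ * _); apply: eq_bigr => i _; rewrite rmorphXn.
Qed.

Lemma rmorph_esym (I : finType) (x : I -> R) k :
  f (esym x k) = esym (f \o x) k.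
Proof.
by rewrite rmorph_sum; apply: eq_bigr => A _; rewrite rmorph_prod.
Qed.
End NewtonMorphism.

Lemma eq_mmap (R S : comNzRingType) (n : nat) (f1 f2 : R -> S) (h1 h2 : 'I_n -> S) :
  f1 =1 f2 -> h1 =1 h2 -> mmap f1 h1 =1 mmap f2 h2.
Proof.
move=> ef eh p; rewrite /mmap; apply: eq_bigr => m _; rewrite ef; congr (_ * _).
exact: mmap1_eq.
Qed.

Lemma torsion_free_int : torsion_free int.
Proof. by move=> k x k0 /eqP; rewrite mulrn_eq0 => /orP[|/eqP//]; case: k k0. Qed.

Lemma torsion_free_mpoly (R : comNzRingType) (n : nat) :
  torsion_free R -> torsion_free {mpoly R[n]}.
Proof.
move=> tf k p k0 /mpolyP e; apply/mpolyP => m.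
by have := e m; rewrite mcoeffMn !mcoeff0 => /(tf _ _ k0).
Qed.

(** A permutation of the variables fixes the factorial multiple of [y], hence [y] itself by
    torsion-freeness. *)
Lemma symmetric_factorial_esym (R : comNzRingType) (n k : nat)
  (P : nat -> {mpoly R[n]}) (y : {mpoly R[n]}) :
  torsion_free R -> y *+ k`! = factorial_esym P k ->
  (forall l, (0 < l)%N -> P l \is symmetric) -> y \is symmetric.
Proof.
move=> tf yE symP; apply/issymP => s.
apply: (torsion_free_inj (torsion_free_mpoly tf) (fact_gt0 k)).
rewrite -msymMn yE (rmorph_factorial_esym (msym s)).
apply: eq_factorial_esym => l /andP[l0 _]; exact: (issymP _ (symP l l0)).
Qed.

(** * Generic elementary symmetric functions and their power sums *)

Section Indeterminates.
Variables (R : comNzRingType) (n : nat).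

(** The sequence 1, X_0, ..., X_(n-1), 0, 0, ...: the elementary symmetric functions of a generic
    family of [n] roots. *)
Definition indet (a : nat) : {mpoly R[n]} :=
  if a is b.+1 then oapp (fun i : 'I_n => 'X_i) 0 (insub b) else 1.

Lemma indet_gt a : (n < a)%N -> indet a = 0.
Proof. by case: a => //= a; rewrite ltnS => an; rewrite insubN // -leqNgt. Qed.

Lemma mmap_indet (S : comNzRingType) (f : {rmorphism R -> S}) (w : nat -> S) a :
  w 0%N = 1 -> (a <= n)%N -> mmap f (fun i : 'I_n => w i.+1) (indet a) = w a.
Proof.
move=> w0; case: a => [|a] an /=; first by rewrite rmorph1 w0.
by rewrite insubT /= mmapX mmap1U.
Qed.

(** The bound [l <= n] is where [w] and the evaluated [indet] agree; beyond it [indet] vanishes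
    while [w] may not. *)
Lemma mmap_power_sum_indet (S : comNzRingType) (f : {rmorphism R -> S})
    (w P : nat -> S) l : newton w P -> (0 < l <= n)%N ->
  mmap f (fun i : 'I_n => w i.+1) (power_sum indet l) = P l.
Proof.
move=> nw ln; pose g : {rmorphism {mpoly R[n]} -> S} := mmap f (fun i : 'I_n => w i.+1).
have ng := newton_rmorph g (newton_power_sum (erefl : indet 0 = 1)).
apply: (newton_unique (M := n) _ ng nw) => // i iM.
by rewrite /= mmap_indet //; case: nw.
Qed.

Definition esym_tuple := [tuple mesym n R i.+1 | i < n].

Lemma comp_indet a : indet a \mPo esym_tuple = esym (fun i : 'I_n => 'X_i) a.
Proof.
have [an|na] := leqP a n; last first.
  by rewrite indet_gt // comp_mpoly0 -(mesym_geqnE _ na).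
rewrite -(@mmap_indet _ (@mpolyC n R) (esym (fun i : 'I_n => 'X_i))) //.
  by apply: eq_mmap => // i; rewrite tnth_mktuple.
by rewrite -(mesym0E n R).
Qed.

Lemma comp_power_sum_indet l : (0 < l)%N ->
  power_sum indet l \mPo esym_tuple = \sum_(i < n) 'X_i ^+ l.
Proof.
move=> l0; pose g : {rmorphism {mpoly R[n]} -> {mpoly R[n]}} := comp_mpoly esym_tuple.
have ng := newton_rmorph g (newton_power_sum (erefl : indet 0 = 1)).
apply: (newton_unique (M := l) _ ng (newton_esym (fun i : 'I_n => 'X_i))) => [i _|].
  exact: comp_indet.
by rewrite l0 /=.
Qed.

Lemma msymXi (s : 'S_n) i : msym s 'X_i = 'X_(s i) :> {mpoly R[n]}.
Proof. by rewrite /msym mmapX mmap1U. Qed.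

Lemma symmetric_power_sum l : \sum_(i < n) 'X_i ^+ l \is @symmetric n R.
Proof.
apply/issymP => s; rewrite rmorph_sum [RHS](reindex_inj (@perm_inj _ s)).
by apply: eq_bigr => i _; rewrite rmorphXn /= msymXi.
Qed.
End Indeterminates.
Arguments indet {R} n a.

Lemma eq_esym (R : comNzRingType) (I : finType) (x y : I -> R) k :
  x =1 y -> esym x k = esym y k.
Proof. by move=> xy; apply: eq_bigr => A _; apply: eq_bigr. Qed.

Definition product_args (S : Type) (k : nat) (w z : nat -> S) (i : 'I_(k + k)) : S :=
  match split i with inl a => w a.+1 | inr b => z b.+1 end.

(** The roots of a product are the products of roots, so their power sums multiply. The second
    clause transfers this to every Newton pair in every ring, where no roots need exist. *)
Lemma universal_product (k : nat) : exists2 Q : {mpoly int[k + k]}, is_Pk Q &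
  forall (S : comNzRingType) (f : {rmorphism int -> S}) (w z P P' : nat -> S),
    newton w P -> newton z P' ->
    mmap f (product_args w z) Q *+ k`! = factorial_esym (fun l => P l * P' l) k.
Proof.
(* The elementary symmetric functions of the second family become indeterminates of the coefficient
   ring; only the first family is split into roots ['X_i]. *)
pose NV : nat -> {mpoly int[k]} := power_sum (indet k).
have newV : newton (indet k) NV by apply: newton_power_sum.
pose newC := newton_rmorph (@mpolyC k {mpoly int[k]}) newV.
(* Each factor stands for the product over the second family's roots [y] of [1 + 'X_i y t], already
   expanded in its elementary symmetric functions. *)
pose T : {mpoly {mpoly int[k]}[k]} :=
  (\prod_(i < k) \poly_(a < k.+1) ('X_i ^+ a * (indet k a)%:MP))`_k.
have newT : T *+ k`! =
    factorial_esym (fun l => (\sum_(i < k) 'X_i ^+ l) * (NV l)%:MP) k.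
  have new1 (i : 'I_k) : newton
      (nth 0 (\poly_(a < k.+1) ('X_i ^+ a * (indet k a)%:MP)) : nat -> {mpoly {mpoly int[k]}[k]})
      (fun l => 'X_i ^+ l * (NV l)%:MP).
    apply: eq_newton (newton_scale 'X_i newC) => a //=.
    by rewrite coef_poly; case: ltnP => // ka; rewrite indet_gt // mpolyC0 mulr0.
  apply: newton_factorial_esym; apply: eq_newton (newton_prod new1) => // l.
  by rewrite mulr_suml.
have tfB : torsion_free {mpoly int[k]} by apply/torsion_free_mpoly/torsion_free_int.
have symT : T \is symmetric.
  apply: symmetric_factorial_esym newT _ => // l l0.
  by rewrite rpredM ?symmetric_power_sum //; apply/issymP => s; rewrite /msym mmapC.
have [Qt [QtT _]] := sym_fundamental symT.
have QtE : Qt *+ k`! =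
    factorial_esym (fun l => power_sum (indet k) l * (NV l)%:MP) k.
  apply: msym_fundamental_un; rewrite comp_mpolyMn QtT newT.
  rewrite (rmorph_factorial_esym (comp_mpoly _)).
  apply: eq_factorial_esym => l /andP[l0 _] /=.
  by rewrite rmorphM /= comp_power_sum_indet // comp_mpolyC.
(* Flattening: outer variables go to the left block, the indeterminates of the coefficients to the
   right block. *)
pose Q : {mpoly int[k + k]} :=
  mmap (mmap (@mpolyC (k + k) int) (fun b => 'X_(rshift k b))) (fun a => 'X_(lshift k a)) Qt.
have QE (S : comNzRingType) (f : {rmorphism int -> S}) (w z P P' : nat -> S) :
    newton w P -> newton z P' ->
    mmap f (product_args w z) Q *+ k`! = factorial_esym (fun l => P l * P' l) k.
  move=> nw nz; rewrite (rmorph_mmap (mmap f _)).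
  pose fB : {rmorphism {mpoly int[k]} -> S} := mmap f (fun b : 'I_k => z b.+1).
  rewrite (eq_mmap (f2 := fB) (h2 := fun a : 'I_k => w a.+1)); first last.
  - by move=> a /=; rewrite mmapX mmap1U /product_args (unsplitK (inl a)).
  - move=> p /=; rewrite (rmorph_mmap (mmap f _)); apply: eq_mmap => b /=.
      by rewrite mmapC.
    by rewrite mmapX mmap1U /product_args (unsplitK (inr b)).
  rewrite -(rmorphMn (mmap fB _)) QtE (rmorph_factorial_esym (mmap fB _)).
  apply: eq_factorial_esym => l ln /=; rewrite rmorphM /=.
  rewrite (mmap_power_sum_indet fB nw) // mmapC.
  by congr (_ * _); apply: mmap_power_sum_indet.
(* The defining identity of [is_Pk] is the evaluation formula at the elementary symmetric functions
   of two families of variables. *)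
exists Q => //; rewrite /is_Pk.
have tf : torsion_free {mpoly int[k + k]} by apply/torsion_free_mpoly/torsion_free_int.
apply: (torsion_free_inj tf (fact_gt0 k)).
pose xi (i : 'I_k) : {mpoly int[k + k]} := 'X_(lshift k i).
pose eta (i : 'I_k) : {mpoly int[k + k]} := 'X_(rshift k i).
have argsE : tnth (Pk_args k) =1 product_args (esym xi) (esym eta).
  move=> i; rewrite tnth_mktuple /product_args.
  by case: split => j; rewrite (rmorph_esym (comp_mpoly _));
    apply: eq_esym => b /=; rewrite comp_mpolyXU -tnth_nth tnth_mktuple.
rewrite /comp_mpoly (eq_mmap (frefl _) argsE).
rewrite (QE _ _ _ _ _ _ (newton_esym xi) (newton_esym eta)).
rewrite (newton_factorial_esym k (newton_esym (fun ij => xi ij.1 * eta ij.2))).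
apply: eq_factorial_esym => l _; rewrite big_distrlr pair_bigA /=.
by apply: eq_bigr => ij _; rewrite exprMn.
Qed.

(** [G l] expresses, in elementary symmetric functions, the [l]-th power sum of all products of [j]
    distinct roots, that is, the [j]-th elementary symmetric function of the [l]-th powers. The
    bound [l <= k] keeps every index [l * b] within the [k * j] variables. *)
Lemma universal_composition (k j : nat) : exists2 Q : {mpoly int[k * j]}, is_Pkj Q &
  exists G : nat -> {mpoly int[k * j]},
  forall (S : comNzRingType) (f : {rmorphism int -> S}) (w P : nat -> S),
    newton w P -> let ev := mmap f (fun i : 'I_(k * j) => w i.+1) in
    ev Q *+ k`! = factorial_esym (ev \o G) k /\
    forall l, (0 < l <= k)%N ->
      ev (G l) *+ j`! = factorial_esym (fun b => P (l * b)%N) j.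
Proof.
set M := (k * j)%N.
have tf : torsion_free {mpoly int[M]} by apply/torsion_free_mpoly/torsion_free_int.
pose H l : {mpoly int[M]} := esym (fun i : 'I_M => 'X_i ^+ l) j.
have HE l : H l *+ j`! = factorial_esym (fun b => \sum_(i < M) 'X_i ^+ (l * b)) j.
  rewrite (newton_factorial_esym j (newton_esym (fun i : 'I_M => 'X_i ^+ l))).
  apply: eq_factorial_esym => b _.
  by apply: eq_bigr => i _; rewrite exprM.
have symH l : H l \is symmetric.
  apply: symmetric_factorial_esym (HE l) _; first exact: torsion_free_int.
  by move=> b _; exact: symmetric_power_sum.
have G l : {g | g \mPo esym_tuple int M = H l}.
  by have [g [gE _]] := sym_fundamental (symH l); exists g.
have GE l : (0 < l)%N -> sval (G l) *+ j`! =
    factorial_esym (fun b => power_sum (indet M) (l * b)%N) j.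
  move=> l0; apply: msym_fundamental_un.
  rewrite comp_mpolyMn (svalP (G l)) HE (rmorph_factorial_esym (comp_mpoly _)).
  apply: eq_factorial_esym => b /andP[b0 _] /=.
  by rewrite comp_power_sum_indet // muln_gt0 l0.
(* Subsets of the wrong size count as zero roots, so that the target becomes an [esym] over the
   finite type of all subsets. *)
pose x (A : {set 'I_M}) : {mpoly int[M]} := if #|A| == j then \prod_(i in A) 'X_i else 0.
have WE : Pkj_target k j *+ k`! = factorial_esym H k.
  have -> : Pkj_target k j = esym x k.
    rewrite /Pkj_target /esym big_mkcondr; apply: eq_bigr => F _.
    case: forallP => [Fj|/forallP]; first apply: eq_bigr => A AF.
      by have /implyP/(_ AF) := Fj A; rewrite /x => ->.
    case/forallPn => A; rewrite negb_imply => /andP[AF Aj].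
    by rewrite (bigD1 A) //= /x (negPf Aj) mul0r.
  rewrite (newton_factorial_esym k (newton_esym x)).
  apply: eq_factorial_esym => l /andP[l0 _]; rewrite /H /esym [RHS]big_mkcond.
  apply: eq_bigr => A _; rewrite /x; case: ifP => _.
    by rewrite prodrXl.
  by rewrite expr0n (gtn_eqF l0).
have symW : Pkj_target k j \is symmetric.
  by apply: symmetric_factorial_esym WE _ => //; exact: torsion_free_int.
have [Q [QW _]] := sym_fundamental symW.
exists Q => //; exists (fun l => sval (G l)) => S f w P nw ev.
have QE : Q *+ k`! = factorial_esym (fun l => sval (G l)) k.
  apply: msym_fundamental_un.
  rewrite comp_mpolyMn QW WE (rmorph_factorial_esym (comp_mpoly _)).
  by apply: eq_factorial_esym => l _ /=; rewrite (svalP (G l)).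
split=> [|l /andP[l0 lk]]; rewrite /ev -(rmorphMn (mmap f _)).
  by rewrite QE (rmorph_factorial_esym (mmap f _)).
rewrite GE // (rmorph_factorial_esym (mmap f _)).
apply: eq_factorial_esym => b /andP[b0 bj] /=.
by apply: (mmap_power_sum_indet f nw); rewrite muln_gt0 l0 b0 leq_mul.
Qed.

(** * Adams operations of a torsion-free lambda-ring *)

(** The axioms as equalities in an actual ring instead of between truncated representatives; [c]
    embeds the coefficients of the universal polynomials. *)
Record lambda_axioms (A : comNzRingType) (c : int -> A) (lam : nat -> A -> A) : Prop := {
  lambda0 : forall a, lam 0%N a = 1;
  lambda1 : forall a, lam 1%N a = a;
  lambdaD : forall k a b, lam k (a + b) = \sum_(i < k.+1) lam i a * lam (k - i)%N b;
  lambda_one : forall k, (2 <= k)%N -> lam k 1 = 0;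
  lambdaM : forall k (Q : {mpoly int[k + k]}) a b, (0 < k)%N -> is_Pk Q ->
    lam k (a * b) = mmap c (product_args (lam^~ a) (lam^~ b)) Q;
  lambda_comp : forall k j (Q : {mpoly int[k * j]}) a,
    (0 < k)%N -> (0 < j)%N -> is_Pkj Q ->
    lam k (lam j a) = mmap c (fun i : 'I_(k * j) => lam i.+1 a) Q }.

Section AdamsOperations.
Variables (A : comNzRingType) (c : {rmorphism int -> A}) (lam : nat -> A -> A).
Hypotheses (tfA : torsion_free A) (lamP : lambda_axioms c lam).

Definition adams k (a : A) : A := power_sum (lam^~ a) k.

Lemma newton_adams a : newton (lam^~ a) (adams^~ a).
Proof. by apply: newton_power_sum; exact: lambda0 lamP a. Qed.

Lemma adams_1 a : adams 1 a = a.
Proof. by rewrite /adams power_sumS big_ord0 add0r !mul1r (lambda1 lamP). Qed.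

Lemma adamsD k a b : (0 < k)%N -> adams k (a + b) = adams k a + adams k b.
Proof.
move=> k0; have nab := newton_mul (newton_adams a) (newton_adams b).
apply: (newton_unique (M := k) _ (newton_adams (a + b)) nab); last by rewrite k0 /=.
by move=> i _; exact: lambdaD lamP i a b.
Qed.

Lemma adams_one k : (0 < k)%N -> adams k 1 = 1.
Proof.
move=> k0; rewrite -[RHS](expr1n _ k).
apply: (newton_unique (M := k) _ (newton_adams 1) (newton_linear 1)); last by rewrite k0 /=.
move=> [|[|i]] _; rewrite coefD coef1 scale1r coefX /=.
- by rewrite (lambda0 lamP) addr0.
- by rewrite (lambda1 lamP) add0r.
- by rewrite (lambda_one lamP) // addr0.
Qed.

(** The universal product polynomials show that the products of Adams operations satisfy Newton's
    identities for [a * b]; uniqueness of power sums concludes. *)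
Lemma adamsM k a b : (0 < k)%N -> adams k (a * b) = adams k a * adams k b.
Proof.
move=> k0.
have nab : newton (lam^~ (a * b)) (fun l => adams l a * adams l b).
  apply: factorial_esym_newton => // l; have [|l0] := posnP l.
    by move=> ->; rewrite factorial_esym0 (lambda0 lamP).
  have [Q QP QE] := universal_product l.
  by rewrite (lambdaM lamP _ _ l0 QP) (QE _ c _ _ _ _ (newton_adams a) (newton_adams b)).
by apply: (newton_unique (M := k) _ (newton_adams (a * b)) nab) => //; rewrite k0 /=.
Qed.

Lemma adams_rmorphism k : (0 < k)%N -> exists f : {rmorphism A -> A}, f =1 adams k.
Proof.
move=> k0; pose f := adams k.
have fB : zmod_morphism f.
  by move=> a b; apply: (addIr (f b)); rewrite /f -adamsD // !subrK.
have fM : monoid_morphism f by split=> [|a b]; rewrite /f ?adams_one ?adamsM.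
pose F : {rmorphism A -> A} := HB.pack f (GRing.isZmodMorphism.Build A A f fB)
  (GRing.isMonoidMorphism.Build A A f fM).
by exists F.
Qed.

(** Induction on [k]: the composition axiom equates the factorial expressions built from [adams] at
    [lam j a] and from the evaluated [G]. Earlier entries agree by induction, so the last ones do
    too. *)
Lemma adams_lambda k j a : (0 < k)%N -> (0 < j)%N ->
  adams k (lam j a) *+ j`! = factorial_esym (fun b => adams (k * b) a) j.
Proof.
move=> k0 j0; elim/ltn_ind: k k0 => -[//|k] IH _.
have [Q QP [G QG]] := universal_composition k.+1 j.
have [QE GE] := QG _ c _ _ (newton_adams a).
rewrite -GE ?leqnn //; congr (_ *+ _).
move: QE; rewrite -(lambda_comp lamP a _ j0 QP) //.
rewrite (newton_factorial_esym _ (newton_adams _)).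
apply: factorial_esym_last => // i /andP[i0 ik].
apply: (torsion_free_inj tfA (fact_gt0 j)).
by rewrite IH // [RHS]GE // i0 leqW.
Qed.

(** Apply the ring endomorphism [adams k] to the relation giving [lam j a] from the Adams operations
    of [a], and compare with [adams_lambda]; induction on [j] isolates the last term. *)
Lemma adams_comp k j a : (0 < k)%N -> (0 < j)%N ->
  adams k (adams j a) = adams (k * j) a.
Proof.
move=> k0; have [F FE] := adams_rmorphism k0.
elim/ltn_ind: j => -[//|j] IH _.
apply: (@factorial_esym_last _ j (fun b => adams k (adams b a)) (fun b => adams (k * b) a)) => //.
  by move=> i /andP[i0 ij]; rewrite IH.
rewrite -adams_lambda // -FE -rmorphMn (newton_factorial_esym _ (newton_adams _)).
by rewrite rmorph_factorial_esym; apply: eq_factorial_esym => i _ /=; rewrite FE.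
Qed.
End AdamsOperations.

Lemma newton_esym_unique (R : comNzRingType) (u v P Q : nat -> R) k :
  torsion_free R -> newton u P -> newton v Q ->
  (forall l, (0 < l)%N -> P l = Q l) -> u k = v k.
Proof.
move=> tf nu nv PQ; apply: (torsion_free_inj tf (fact_gt0 k)).
rewrite (newton_factorial_esym k nu) (newton_factorial_esym k nv).
by apply: eq_factorial_esym => l /andP[/PQ].
Qed.

(* By torsion-freeness the lambda operations are determined by the Adams
   operations, and these by the ones of prime index. *)
Lemma rmorph_lambda (A : comNzRingType) (c : {rmorphism int -> A})
    (lam1 lam2 : nat -> A -> A) (f : {rmorphism A -> A}) :
  torsion_free A -> lambda_axioms c lam1 -> lambda_axioms c lam2 ->
  (forall p a, prime p -> f (adams lam1 p a) = adams lam2 p (f a)) ->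
  forall k a, f (lam1 k a) = lam2 k (f a).
Proof.
move=> tf lam1P lam2P fp.
have fk k a : (0 < k)%N -> f (adams lam1 k a) = adams lam2 k (f a).
  elim/ltn_ind: k a => k IH a k0; have [k1|k1] := leqP k 1.
    have -> : k = 1%N by lia.
    by rewrite (adams_1 lam1P) (adams_1 lam2P).
  (* Splitting off the least prime factor reduces to a smaller index by [adams_comp]. *)
  have pp := pdiv_prime k1; have /dvdnP [m km] := pdiv_dvd k.
  have m0 : (0 < m)%N by move: k0; rewrite km; case: (m).
  have mk : (m < k)%N by rewrite km ltn_Pmulr // prime_gt1.
  rewrite km mulnC -(adams_comp tf lam1P) ?pdiv_gt0 // -(adams_comp tf lam2P) ?pdiv_gt0 //.
  by rewrite fp ?IH.
move=> k a; apply: (newton_esym_unique k tf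
  (newton_rmorph f (newton_adams lam1P a)) (newton_adams lam2P (f a))).
by move=> l l0 /=; rewrite fk.
Qed.

(** * Truncated polynomials *)

Section TruncatedPolynomials.
Variable N : nat.

(** The quotient as a ring type, to which the results on torsion-free rings apply; [to_truncP] links
    its equality to [tr]. *)
Definition trunc_ring := {poly %/ ('X^(N.+1) : {poly int})}.
HB.instance Definition _ := GRing.ComNzRing.on trunc_ring.

Definition to_trunc (p : {poly int}) : trunc_ring := in_qpoly 'X^(N.+1) p.
HB.instance Definition _ := GRing.RMorphism.copy to_trunc (in_qpoly ('X^(N.+1) : {poly int})).

Lemma to_truncP p q : to_trunc p = to_trunc q <-> tr N.+1 p = tr N.+1 q.
Proof.
rewrite /tr !Pdiv.RingMonic.take_poly_rmodp -(mk_monic_Xn int N.+1).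
by split=> [/(congr1 val)|e]; last exact: val_inj.
Qed.

Lemma to_trunc_coef p q :
  to_trunc p = to_trunc q <-> (forall i, (i <= N)%N -> p`_i = q`_i).
Proof.
rewrite to_truncP; split=> [e i iN|e].
  by have := congr1 (fun h : {poly int} => h`_i) e; rewrite !coef_take_poly ltnS iN.
by apply/polyP => i; rewrite !coef_take_poly ltnS; case: ifP => // /e.
Qed.

Lemma to_truncK (a : trunc_ring) : to_trunc (val a) = a.
Proof. by apply: val_inj; rewrite /= Pdiv.CommonRing.rmodp_small // size_mk_monic. Qed.

Lemma torsion_free_trunc : torsion_free trunc_ring.
Proof.
move=> k a k0; rewrite -(to_truncK a) -rmorphMn -(rmorph0 to_trunc).
move/to_trunc_coef => e; apply/to_trunc_coef => i iN.
by have := e i iN; rewrite coefMn coef0; exact: torsion_free_int.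
Qed.

(** * Substitution in truncated polynomials *)

Lemma coef_expr_low (g : {poly int}) i j : g`_0 = 0 -> (j < i)%N -> (g ^+ i)`_j = 0.
Proof.
move=> g0 ji; have /factor_theorem [h ->] : root g 0 by rewrite /root horner_coef0 g0.
by rewrite polyC0 subr0 exprMn coefMXn ji.
Qed.

(** Powers [g ^+ i] have order at least [i], so terms of degree above [j] cannot reach the
    coefficient of index [j]. *)
Lemma coef_comp_low (p q g : {poly int}) j : g`_0 = 0 ->
  (forall i, (i <= j)%N -> p`_i = q`_i) -> (p \Po g)`_j = (q \Po g)`_j.
Proof.
move=> g0 pq; apply/eqP; rewrite -subr_eq0 -coefB -comp_polyB comp_polyE coef_sum.
apply/eqP/big1 => i _; rewrite coefZ coefB; have [ij|ji] := leqP i j.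
  by rewrite pq // subrr mul0r.
by rewrite coef_expr_low ?mulr0.
Qed.

Lemma to_trunc_compl (p q g : {poly int}) : g`_0 = 0 ->
  to_trunc p = to_trunc q -> to_trunc (p \Po g) = to_trunc (q \Po g).
Proof.
move=> g0 /to_trunc_coef pq; apply/to_trunc_coef => i iN.
by apply: coef_comp_low => // j ji; apply: pq; exact: leq_trans iN.
Qed.

Lemma to_trunc_compr (f p q : {poly int}) :
  to_trunc p = to_trunc q -> to_trunc (f \Po p) = to_trunc (f \Po q).
Proof.
move=> pq; elim/poly_ind: f => [|f k IH]; first by rewrite !comp_poly0.
by rewrite !comp_polyD !comp_polyM !comp_polyX !comp_polyC !rmorphD !rmorphM /= IH pq.
Qed.

Lemma rmorph_to_trunc (F : {rmorphism trunc_ring -> trunc_ring}) (y p : {poly int}) :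
  F (to_trunc 'X) = to_trunc y -> F (to_trunc p) = to_trunc (p \Po y).
Proof.
move=> Fy; elim/poly_ind: p => [|p k IH]; first by rewrite comp_poly0 !rmorph0.
rewrite comp_polyD comp_polyM comp_polyX comp_polyC !rmorphD !rmorphM /= IH Fy.
by rewrite -(intz k) !rmorph_int.
Qed.

Lemma subst_rmorphism (y : {poly int}) : y`_0 = 0 ->
  exists F : {rmorphism trunc_ring -> trunc_ring},
    forall p, F (to_trunc p) = to_trunc (p \Po y).
Proof.
move=> y0; pose f (a : trunc_ring) : trunc_ring := to_trunc (val a \Po y).
have fE p : f (to_trunc p) = to_trunc (p \Po y).
  by apply: to_trunc_compl => //; rewrite to_truncK.
have fB : zmod_morphism f.
  move=> a b; rewrite -(to_truncK a) -(to_truncK b) -rmorphB !fE.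
  by rewrite comp_polyB rmorphB.
have fM : monoid_morphism f.
  split=> [|a b]; first by rewrite -(rmorph1 to_trunc) fE comp_polyC.
  rewrite -(to_truncK a) -(to_truncK b) -rmorphM !fE.
  by rewrite comp_polyM rmorphM.
pose F : {rmorphism trunc_ring -> trunc_ring} :=
  HB.pack f (GRing.isZmodMorphism.Build trunc_ring trunc_ring f fB)
    (GRing.isMonoidMorphism.Build trunc_ring trunc_ring f fM).
by exists F.
Qed.

Lemma to_trunc_mulXN (h : {poly int}) :
  to_trunc (h * 'X^N) = to_trunc (h`_0 *: 'X^N).
Proof.
apply/to_trunc_coef => i iN; rewrite coefMXn coefZ coefXn.
case: ltngtP iN => // [|->]; first by rewrite mulr0.
by rewrite subnn mulr1.
Qed.

(** First-order Taylor expansion: [x] kills [x^N], so of the derivative of [f] at [g] only its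
    constant term [f_1] survives. *)
Lemma to_trunc_compD (f g : {poly int}) (b : int) : (0 < N)%N -> g`_0 = 0 ->
  to_trunc (f \Po (g + b *: 'X^N)) = to_trunc (f \Po g + (f`_1 * b) *: 'X^N).
Proof.
move=> N0 g0; elim/poly_ind: f => [|f k IH].
  by rewrite !comp_poly0 coef0 mul0r scale0r addr0.
rewrite !comp_polyD !comp_polyM !comp_polyX !comp_polyC.
have -> : (f * 'X + k%:P)`_1 = f`_0 by rewrite coefD coefMX coefC addr0.
rewrite rmorphD rmorphM /= IH -rmorphM -rmorphD.
have -> : (f \Po g + (f`_1 * b) *: 'X^N) * (g + b *: 'X^N) + k%:P =
  (f \Po g) * g + k%:P + ((f \Po g) * b%:P + (f`_1 * b)%:P * (g + b *: 'X^N)) * 'X^N.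
  by rewrite -!mul_polyC; ring.
rewrite rmorphD /= to_trunc_mulXN -rmorphD; congr (to_trunc (_ + _ *: _)).
rewrite coefD !coefMC coefCM !coefD coefZ coefXn g0 eq_sym (gtn_eqF N0) mulr0 addr0 mulr0 addr0.
by rewrite -horner_coef0 horner_comp horner_coef0 g0 horner_coef0.
Qed.

(** Besides the Taylor term, [a x^N] contributes [a] times the [N]-th power of the inner polynomial,
    whose lowest term is [g_1^N x^N]; as [N > 1], the perturbation leaves [g_1] unchanged. *)
Lemma to_trunc_comp (f g : {poly int}) (a b : int) : (1 < N)%N -> g`_0 = 0 ->
  to_trunc ((f + a *: 'X^N) \Po (g + b *: 'X^N)) =
  to_trunc (f \Po g + (f`_1 * b + a * g`_1 ^+ N) *: 'X^N).
Proof.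
move=> N1 g0; set y := g + b *: 'X^N.
have coefy i : (i < N)%N -> y`_i = g`_i.
  by move=> iN; rewrite coefD coefZ coefXn (ltn_eqF iN) mulr0 addr0.
have /factor_theorem [h hE] : root y 0.
  by rewrite /root horner_coef0 coefy ?g0 // ltnW.
rewrite polyC0 subr0 in hE.
have h0 : h`_0 = g`_1 by rewrite -(coefy 1%N) // hE coefMX.
rewrite comp_polyD comp_polyZ comp_Xn_poly rmorphD /= (to_trunc_compD f b (ltnW N1) g0).
rewrite hE exprMn scalerAl to_trunc_mulXN -rmorphD /= coefZ.
by rewrite -horner_coef0 horner_exp horner_coef0 h0 scalerDl addrA.
Qed.

End TruncatedPolynomials.

(** * Filtered lambda-ring structures on truncated polynomials *)

Lemma psi_power_sum (lam : lamops) (m : nat) (x : {poly int}) :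
  psi lam m x = power_sum (lam^~ x) m.
Proof.
rewrite /psi /power_sum; congr (nth 0 _ _).
by elim: m => //= m ->.
Qed.

Lemma rmorph_power_sum (R S : comNzRingType) (f : {rmorphism R -> S})
    (u : nat -> R) (v : nat -> S) k :
  (forall i, f (u i) = v i) -> (0 < k)%N -> f (power_sum u k) = power_sum v k.
Proof.
move=> fu; elim/ltn_ind: k => -[//|k] IH _.
rewrite !power_sumS rmorphD !rmorphM rmorphXn rmorphN1 rmorph_nat fu rmorph_sum.
congr (_ + _); apply: eq_bigr => i _; have /= ik := ltn_ord i.
by rewrite !rmorphM rmorphXn rmorphN1 fu IH //; lia.
Qed.

(* Modulo [x^2] every product in Newton's formula vanishes. *)
Lemma coef1_power_sum (u : nat -> {poly int}) (k : nat) :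
  (forall i, (0 < i)%N -> (u i)`_0 = 0) ->
  (power_sum u k.+1)`_0 = 0 /\
  (power_sum u k.+1)`_1 = (-1) ^+ k * k.+1%:R * (u k.+1)`_1.
Proof.
move=> u0; elim/ltn_ind: k => k IH; rewrite power_sumS !coefD !coef_sum.
have sE : (-1) ^+ k * k.+1%:R * u k.+1 = ((-1) ^+ k * k.+1%:R)%:P * u k.+1.
  by rewrite rmorphM rmorphXn rmorphN1 rmorph_nat.
have P0 (j : 'I_k) : (power_sum u (k - j))`_0 = 0.
  have /= jk := ltn_ord j; have -> : (k - j = (k - j.+1).+1)%N by lia.
  by case: (IH (k - j.+1)%N) => //; lia.
have s0 (j : nat) : ((-1) ^+ j * u j.+1)`_0 = 0 by rewrite coef0M u0 // mulr0.
rewrite sE !coefCM u0 // mulr0 addr0; split.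
  by rewrite big1 // => j _; rewrite coef0M P0 mulr0.
rewrite big1 ?add0r // => j _.
by rewrite coefM big_ord_recl big_ord1 /= P0 s0 mulr0 mul0r addr0.
Qed.

Section FilteredLambdaRing.
Variables (N d : nat) (lam : lamops).
Hypothesis d1 : (1 <= d)%N.
Hypothesis lamP : is_filtered_lambda_ring N.+1 d lam.

Definition trunc_lambda (i : nat) (a : trunc_ring N) : trunc_ring N :=
  to_trunc N (lam i (val a)).

Lemma trunc_lambdaE i p : to_trunc N (lam i p) = trunc_lambda i (to_trunc N p).
Proof.
case: lamP => -[lam_tr _] _; apply/to_truncP/lam_tr/to_truncP.
by rewrite to_truncK.
Qed.

Lemma trunc_lambda_axioms : lambda_axioms (to_trunc N \o polyC) trunc_lambda.
Proof.
have [[_ [l0 [l1 [lD [lone [lM lC]]]]]] _] := lamP.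
split.
- by move=> a; rewrite /trunc_lambda -(rmorph1 (to_trunc N)); apply/to_truncP/l0.
- by move=> a; rewrite -[RHS]to_truncK; apply/to_truncP/l1.
- move=> k a b; rewrite -{1}(to_truncK a) -{1}(to_truncK b) -rmorphD -trunc_lambdaE.
  have /to_truncP -> := lD k (val a) (val b); rewrite rmorph_sum.
  by apply: eq_bigr => i _; rewrite rmorphM.
- move=> k k2; rewrite -(rmorph1 (to_trunc N)) -trunc_lambdaE -(rmorph0 (to_trunc N)).
  by apply/to_truncP; rewrite lone // /tr take_poly0r.
- move=> k Q a b k0 QP; rewrite -{1}(to_truncK a) -{1}(to_truncK b) -rmorphM -trunc_lambdaE.
  have /to_truncP -> := lM k Q (val a) (val b) k0 QP.
  rewrite (rmorph_mmap (to_trunc N)); apply: eq_mmap => // i.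
  by rewrite /= /product_args; case: split.
- move=> k j Q a k0 j0 QP; rewrite -{1}(to_truncK a) -!trunc_lambdaE.
  have /to_truncP -> := lC k j Q (val a) k0 j0 QP.
  by rewrite (rmorph_mmap (to_trunc N)).
Qed.

Lemma trunc_adams k p : (0 < k)%N ->
  adams trunc_lambda k (to_trunc N p) = to_trunc N (psi lam k p).
Proof.
move=> k0; rewrite psi_power_sum; symmetry.
by apply: (@rmorph_power_sum _ _ (to_trunc N) (lam^~ p)) => // i; exact: trunc_lambdaE.
Qed.

(** Since [d >= 1], [x] lies in the first filtration ideal, so each [lam i 'X] with [i > 0] has no
    constant term. Newton's formula modulo [x^2] then leaves only the term with factor [p]. *)
Lemma dvd_coef1_psi p : prime p -> (p %| (psi lam p 'X)`_1)%Z.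
Proof.
case: p => // p _; rewrite psi_power_sum.
have u0 i : (0 < i)%N -> (lam i 'X)`_0 = 0.
  move=> i0; have [_ /(_ i 1%N 'X i0) fil] := lamP.
  apply: fil => //.
  by move=> [|j] _; [rewrite coefX | case: d d1 => // e _; rewrite mulnS].
have [_ ->] := coef1_power_sum p u0.
by rewrite dvdz_mulr // dvdz_mull // natz dvdzz.
Qed.

(** A ring endomorphism of the truncated ring is substitution of the image of [x]. *)
Lemma adams_comp_psi p q : prime p -> (psi lam p 'X)`_0 = 0 ->
  adams trunc_lambda p (to_trunc N q) = to_trunc N (q \Po psi lam p 'X).
Proof.
move=> pp Psi0; have p0 := prime_gt0 pp.
have [F FE] := adams_rmorphism (@torsion_free_trunc N) trunc_lambda_axioms p0.
by rewrite -FE; apply: rmorph_to_trunc; rewrite FE trunc_adams.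
Qed.

Lemma psi_commute p q : prime p -> prime q ->
  (psi lam p 'X)`_0 = 0 -> (psi lam q 'X)`_0 = 0 ->
  to_trunc N (psi lam q 'X \Po psi lam p 'X) = to_trunc N (psi lam p 'X \Po psi lam q 'X).
Proof.
move=> pp pq p0 q0; rewrite -!adams_comp_psi // -!trunc_adams ?prime_gt0 //.
by rewrite !(adams_comp (@torsion_free_trunc N) trunc_lambda_axioms) ?prime_gt0 // mulnC.
Qed.
End FilteredLambdaRing.

(** A substitution without constant term never lowers the order in [x], so it preserves the
    filtration for every [d]. *)
Lemma subst_iso (N d : nat) (lam1 lam2 : lamops) (y z : {poly int}) :
  y`_0 = 0 -> z`_0 = 0 ->
  to_trunc N (y \Po z) = to_trunc N 'X -> to_trunc N (z \Po y) = to_trunc N 'X ->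
  (forall i p, tr N.+1 (lam1 i p \Po y) = tr N.+1 (lam2 i (p \Po y))) ->
  fl_isomorphic N.+1 d lam1 lam2.
Proof.
move=> y0 z0 yz zy lamE.
have fil (w : {poly int}) k p : w`_0 = 0 ->
    inFil N.+1 d k p -> inFil N.+1 d k (p \Po w).
  move=> w0 pk j jN jk; rewrite (@coef_comp_low p 0) // ?comp_poly0 ?coef0 // => i ij.
  rewrite coef0 pk //; first exact: leq_ltn_trans jN.
  by apply: leq_ltn_trans jk; rewrite leq_mul2r ij orbT.
exists (comp_poly y), (comp_poly z); do !split.
- by move=> p q /to_truncP pq; apply/to_truncP/to_trunc_compl.
- by move=> p q /to_truncP pq; apply/to_truncP/to_trunc_compl.
- by move=> p q; rewrite comp_polyD.
- by move=> p q; rewrite comp_polyM.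
- by rewrite comp_polyC.
- move=> p; apply/to_truncP.
  by rewrite -comp_polyA (to_trunc_compr _ yz) comp_polyXr.
- move=> p; apply/to_truncP.
  by rewrite -comp_polyA (to_trunc_compr _ zy) comp_polyXr.
- by move=> k p; exact: fil.
- by move=> k p; exact: fil.
- exact: lamE.
Qed.

(** * Two structures whose Adams operations differ only in top degree *)

Section SharedLowOrderTerms.
Variables (N d : nat) (a : nat -> int) (lam1 lam2 : lamops).
Hypothesis N1 : (1 < N)%N.
Hypotheses (lam1P : is_filtered_lambda_ring N.+1 d lam1)
           (lam2P : is_filtered_lambda_ring N.+1 d lam2).
Hypotheses (psi_const : forall p, prime p -> (psi lam2 p 'X)`_0 = 0)
  (psi_lin : forall p, prime p -> (psi lam2 p 'X)`_1 = a p)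
  (psi_low : forall p i, prime p -> (i < N)%N ->
     (psi lam1 p 'X)`_i = (psi lam2 p 'X)`_i).

Let delta p := (psi lam1 p 'X)`_N - (psi lam2 p 'X)`_N.

Lemma psi_delta p : prime p ->
  to_trunc N (psi lam1 p 'X) = to_trunc N (psi lam2 p 'X + delta p *: 'X^N).
Proof.
move=> pp; apply/to_trunc_coef => i; rewrite coefD coefZ coefXn.
case: ltngtP => // [iN|->] _; first by rewrite psi_low // mulr0 addr0.
by rewrite mulr1 addrC subrK.
Qed.

Lemma delta_proportional p q : prime p -> prime q ->
  delta q * (a p ^+ N - a p) = delta p * (a q ^+ N - a q).
Proof.
move=> pp pq.
have c1 r : prime r -> (psi lam1 r 'X)`_0 = 0.
  by move=> pr; rewrite psi_low ?psi_const // ltnW.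
(* Passing from [lam2] to [lam1] changes the top coefficient of a composite by an explicit
   correction; commutativity in both structures equates the corrections for the two orders. *)
have comp r s : prime r -> prime s -> (psi lam1 r 'X \Po psi lam1 s 'X)`_N =
    (psi lam2 r 'X \Po psi lam2 s 'X)`_N + (a r * delta s + delta r * a s ^+ N).
  move=> pr ps.
  have := etrans (to_trunc_compl (c1 s ps) (psi_delta pr)) (to_trunc_compr _ (psi_delta ps)).
  rewrite to_trunc_comp ?psi_const //.
  move=> /to_trunc_coef/(_ N (leqnn N)) ->.
  by rewrite !psi_lin // coefD coefZ coefXn eqxx mulr1.
have /to_trunc_coef/(_ N (leqnn N)) := psi_commute lam1P pp pq (c1 p pp) (c1 q pq).
have /to_trunc_coef/(_ N (leqnn N)) :=
  psi_commute lam2P pp pq (psi_const pp) (psi_const pq).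
rewrite !comp // => -> /addrI; lia.
Qed.

Lemma isomorphic_of_delta (c : int) :
  (forall p, prime p -> delta p = c * (a p ^+ N - a p)) ->
  fl_isomorphic N.+1 d lam1 lam2.
Proof.
move=> deltaE; have N0 := ltnW N1.
have X0 : 'X`_0 = 0 :> int by rewrite coefX.
have y0 (e : int) : ('X + e *: 'X^N)`_0 = 0.
  by rewrite coefD coefX coefZ coefXn (ltn_eqF N0) mulr0 addr0.
(* Such substitutions compose by adding their coefficients of [x^N]. *)
have inv (e e' : int) : e + e' = 0 ->
    to_trunc N (('X + e *: 'X^N) \Po ('X + e' *: 'X^N)) = to_trunc N 'X.
  move=> ee; rewrite to_trunc_comp // comp_polyX coefX expr1n mul1r mulr1.
  by rewrite [e' + e]addrC ee scale0r addr0.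
apply: (@subst_iso _ _ _ _ ('X + c *: 'X^N) ('X + (- c) *: 'X^N)) => //.
- by apply: inv; rewrite subrr.
- by apply: inv; rewrite addNr.
have [F FE] := subst_rmorphism N (y0 c).
move=> i p; apply/to_truncP; rewrite -FE !(trunc_lambdaE lam1P, trunc_lambdaE lam2P).
rewrite -FE; apply: (rmorph_lambda (@torsion_free_trunc N)
  (trunc_lambda_axioms lam1P) (trunc_lambda_axioms lam2P)) => {p} p b pp.
(* With [y = x + c x^N], what remains is [psi1 o y = y o psi2]. The two sides add [a p * c] and
   [c * a p ^+ N] at [x^N], and [delta p] is the difference. *)
rewrite -(to_truncK b) (adams_comp_psi lam1P) ?psi_low ?psi_const // !FE.
rewrite (adams_comp_psi lam2P) ?psi_const // -!comp_polyA.
apply: to_trunc_compr.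
have -> : to_trunc N (psi lam1 p 'X \Po ('X + c *: 'X^N)) =
    to_trunc N (psi lam1 p 'X + (a p * c) *: 'X^N).
  have := to_trunc_comp (psi lam1 p 'X) 0 c N1 X0.
  by rewrite scale0r addr0 mul0r addr0 comp_polyXr psi_low ?psi_lin.
have := to_trunc_comp 'X c 0 N1 (psi_const pp).
rewrite scale0r addr0 mulr0 add0r comp_polyX psi_lin // => ->.
rewrite !rmorphD /= psi_delta // rmorphD -addrA -rmorphD -scalerDl /=.
by congr (_ + to_trunc N (_ *: _)); rewrite deltaE //; lia.
Qed.
End SharedLowOrderTerms.

(** Counting classes amounts to bounding every finite pairwise non-isomorphic family; a bound for
    each prime gives the minimum. *)
Theorem theorem1p8 (n d : nat) (a : nat -> nat -> int) :
  (3 <= n)%N -> (1 <= d)%N ->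
  (forall p : nat, prime p -> a p 1%N != 0) ->
  forall (m : nat) (L : 'I_m -> lamops),
    (forall r : 'I_m,
       is_filtered_lambda_ring n d (L r) /\
       (forall p : nat, prime p ->
          tr n.-1 (psi (L r) p 'X) = tr n.-1 (\sum_(1 <= i < n.-1) a p i *: 'X^i))) ->
    (forall r s : 'I_m, r != s -> ~ fl_isomorphic n d (L r) (L s)) ->
    forall p : nat, prime p ->
      (m <= `|a p 1%N ^+ n.-1 - a p 1%N|)%N.
Proof.
case: n => [//|N] N2 d1 a0 m L LP noniso p pp /=.
have {N2} N1 : (1 < N)%N by [].
have low r q i : prime q -> (i < N)%N ->
    (psi (L r) q 'X)`_i = (\sum_(1 <= i < N) a q i *: 'X^i)`_i.
  move=> pq iN; have [_ /(_ q pq) e] := LP r.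
  by have := congr1 (fun h : {poly int} => h`_i) e; rewrite !coef_take_poly iN.
have const r q : prime q -> (psi (L r) q 'X)`_0 = 0.
  move=> pq; rewrite low ?(ltnW N1) // coef_sum big_nat big1 // => i /andP[i0 _].
  by rewrite coefZ coefXn (ltn_eqF i0) mulr0.
have lin r q : prime q -> (psi (L r) q 'X)`_1 = a q 1%N.
  move=> pq; rewrite low // coef_sum big_ltn // coefZ coefXn mulr1.
  rewrite big_nat big1 ?addr0 // => i /andP[i1 _].
  by rewrite coefZ coefXn (ltn_eqF i1) mulr0.
set D := a p 1%N ^+ N - a p 1%N.
(* A nonempty family provides a structure witnessing that [p] divides [a p 1]. *)
have [-> //|m0] := posnP m.
have D0 : D != 0.
  have pa : (p %| a p 1%N)%Z.
    have [fr _] := LP (Ordinal m0).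
    by have := dvd_coef1_psi d1 fr pp; rewrite lin.
  (* [D] factors as [a p 1] times [a p 1 ^+ N.-1 - 1]; if the second factor vanished, [p] would
     divide 1, because [N.-1 > 0]. *)
  apply/negP; rewrite /D -(prednK (ltnW N1)) exprS -{3}[a p 1%N]mulr1 -mulrBr.
  rewrite mulf_eq0 (negPf (a0 p pp)) subr_eq0 => /eqP aN.
  have : (p %| a p 1%N ^+ N.-1)%Z by rewrite dvdz_exp //; lia.
  by rewrite aN dvdz1 => /eqP p1; move: (prime_gt1 pp); rewrite -[p]absz_nat p1.
(* Pigeonhole on the residue of the top coefficient modulo [D]. *)
have hP r : (`|((psi (L r) p 'X)`_N %% D)%Z| < `|D|)%N.
  by rewrite -ltz_nat gez0_abs ?modz_ge0 // ltz_mod.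
pose h r : 'I_`|D| := Ordinal (hP r).
suff /leq_card : injective h by rewrite !card_ord.
move=> r s /(congr1 val) /= e; apply/eqP; apply: contraT => rs.
case: (noniso r s rs).
have /eqP := congr1 Posz e; rewrite !gez0_abs ?modz_ge0 // eqz_mod_dvd.
case/dvdzP => c cE.
have [fr _] := LP r; have [fs _] := LP s.
have low2 q i : prime q -> (i < N)%N -> (psi (L r) q 'X)`_i = (psi (L s) q 'X)`_i.
  by move=> pq iN; rewrite !low.
apply: (isomorphic_of_delta N1 fr fs (const s) (lin s) low2 (c := c)) => q pq.
(* The constant [c] found at [p] serves every prime [q]: proportionality gives the claim times [D],
   which is nonzero. *)
apply: (mulIf D0).
rewrite /D (delta_proportional N1 fr fs (const s) (lin s) low2 pp pq) cE /D; ring.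
Qed.
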